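(* Let $n\ge1$, let $\tau\in\mathcal{D}_{2n}$ be the desired terminal density and let $q_K\in\mathcal{D}_{2n}$ be the terminal density obtained by the steering scheme, so that $$\int_{\mathbb{R}} x^{l}q_K(x)\,dx=\int_{\mathbb{R}} x^{l}\tau(x)\,dx,\qquad l=1,\dots,2n.$$ Let $\breve{q}_{K,2n}$ be the differential-entropy maximizing density with these moments, i.e. $\breve{q}_{K,2n}(t)=\exp\big(-\sum_{i=0}^{2n}\lambda_i t^i\big)$, where $\lambda_0,\dots,\lambda_{2n}\in\mathbb{R}$ are determined by $$\int_{\mathbb{R}} t^k\exp\Big(-\sum_{i=0}^{2n}\lambda_i t^i\Big)dt=\int_{\mathbb{R}} t^k\tau(t)\,dt,\qquad k=0,1,\dots,2n.$$ Then the Kolmogorov–Smirnov distance between $q_K$ and $\tau$ satisfies $$V(q_K,\tau)\le 3\left[-1+\left\{1+\tfrac{4}{9}\big(H[\breve{q}_{K,2n}]-H[q_K]\big)\right\}^{1/2}\right]^{1/2}+3\left[-1+\left\{1+\tfrac{4}{9}\big(H[\breve{q}_{K,2n}]-H[\tau]\big)\right\}^{1/2}\right]^{1/2}.$$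
   Context: $\mathcal{D}_{2n}$ denotes the set of probability density functions on $\mathbb{R}$ whose power moments up to order $2n$ are finite. For densities $p,q$ on $\mathbb{R}$ with cumulative distribution functions $F_p,F_q$, the Kolmogorov–Smirnov distance is $V(p,q)=\sup_{t\in\mathbb{R}}|F_p(t)-F_q(t)|$. The differential entropy of a density $q$ is $H[q]=-\int_{\mathbb{R}}q(t)\log q(t)\,dt$, with $0\log 0=0$; if $H[q_K]$ or $H[\tau]$ equals $-\infty$, the right-hand side of the bound is read as $+\infty$. The density $\breve{q}_{K,2n}$ (equivalently, the real parameters $\lambda_0,\dots,\lambda_{2n}$ solving the moment constraints) is assumed to exist. *)

(* Defs.v *)
From HB Require Import structures.
From mathcomp Require Import all_boot all_order all_algebra.
From mathcomp Require Import all_classical all_reals all_analysis.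

Set Implicit Arguments.
Unset Strict Implicit.
Unset Printing Implicit Defensive.

Import Order.TTheory GRing.Theory Num.Theory.
Import numFieldNormedType.Exports.

Local Open Scope classical_set_scope.
Local Open Scope ring_scope.
Local Open Scope ereal_scope.

Definition is_density (R : realType) (p : R -> R) : Prop :=
  [/\ measurable_fun [set: R] p,
      forall x, (0 <= p x)%R &
      \int[lebesgue_measure]_x (p x)%:E = 1].

Definition power_moment (R : realType) (p : R -> R) (k : nat) : \bar R :=
  \int[lebesgue_measure]_x (x ^+ k * p x)%:E.

Definition densities_upto (R : realType) (m : nat) : set (R -> R) :=
  [set p | is_density p /\
    forall k, (k <= m)%N ->
      lebesgue_measure.-integrable [set: R] (fun x : R => (x ^+ k * p x)%:E)].

Definition density_cdf (R : realType) (p : R -> R) (t : R) : \bar R :=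
  \int[lebesgue_measure]_(x in `]-oo, t]) (p x)%:E.

Definition ks_distance (R : realType) (p q : R -> R) : \bar R :=
  ereal_sup (range (fun t : R => `|density_cdf p t - density_cdf q t|)).

(* [ln] is total and the product [0 * ln 0] is 0, as required.  The value is
   the usual one as soon as one of the two parts of [q ln q] is integrable,
   which holds for any density with a finite second moment; it may be -oo. *)
Definition diff_entropy (R : realType) (q : R -> R) : \bar R :=
  - \int[lebesgue_measure]_x (q x * ln (q x))%:E.

Definition maxent_density (R : realType) (m : nat) (lam : 'I_m.+1 -> R)
    (t : R) : R :=
  expR (- \sum_(i < m.+1) lam i * t ^+ i)%R.

(* [d] is a difference of entropies; [d = +oo] gives the value +oo. *)
Definition entropy_bound (R : realType) (d : \bar R) : \bar R :=
  3%:E * sqrte (- 1 + sqrte (1 + (4 / 9)%:E * d)).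

(* Main.v *)
(** Let [p = exp (- S)] be the maximum entropy density and [q] a density with
    the same moments. Then [- \int q ln p = \int q S = \int p S = H[p]], so
    [H[p] - H[q]] is the relative entropy of [q] with respect to [p]. With
    [delta = F_q(t) - F_p(t)], integrating
    [q ln q >= q (- S + h) + q - p exp h] for the step function [h] equal to
    [delta / 2] on [(-oo, t]] and to [- delta / 2] elsewhere gives a weak
    Pinsker inequality, [H[p] - H[q] >= (19 / 36) delta ^ 2]. As
    [|delta| <= 1], this is at least [delta ^ 2 / 2 + delta ^ 4 / 36]; solving
    for [delta] gives
    [|delta| <= 3 (- 1 + (1 + 4 / 9 (H[p] - H[q])) ^ (1 / 2)) ^ (1 / 2)].
    The theorem follows by the triangle inequality through [F_p]. *)

Require Import Defs.
From mathcomp Require Import all_boot all_order all_algebra.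
From mathcomp Require Import all_classical all_reals all_analysis.
From mathcomp Require Import measurable_realfun ring lra.

Set Implicit Arguments.
Unset Strict Implicit.
Unset Printing Implicit Defensive.

Import Order.TTheory GRing.Theory Num.Theory.

Local Open Scope classical_set_scope.
Local Open Scope ring_scope.
Local Open Scope ereal_scope.

(** Bundling integrability with a real value lets linear combinations of integrals be computed in
    [R], free of infinite values. *)
Definition has_integral (R : realType) (f : R -> R) (a : R) : Prop :=
  lebesgue_measure.-integrable [set: R] (fun x => (f x)%:E) /\
  \int[lebesgue_measure]_x (f x)%:E = a%:E.

Lemma has_integralP (R : realType) (f : R -> R) :
  lebesgue_measure.-integrable [set: R] (fun x => (f x)%:E) ->
  has_integral f (fine (\int[lebesgue_measure]_x (f x)%:E)).
Proof. by move=> fi; split => //; rewrite fineK// integrable_fin_num. Qed.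

Lemma has_integralD (R : realType) (f g : R -> R) (a b : R) :
  has_integral f a -> has_integral g b ->
  has_integral (fun x => f x + g x)%R (a + b)%R.
Proof.
move=> [fi fa] [gi gb]; split.
  by under eq_fun do rewrite EFinD; exact: integrableD.
by under eq_integral do rewrite EFinD; rewrite integralD// fa gb.
Qed.

Lemma has_integralZ (R : realType) (f : R -> R) (a c : R) :
  has_integral f a -> has_integral (fun x => c * f x)%R (c * a)%R.
Proof.
move=> [fi fa]; split.
  by under eq_fun do rewrite EFinM; exact: integrableZl.
by under eq_integral do rewrite EFinM; rewrite integralZl// fa.
Qed.

Lemma has_integral_sum (R : realType) (m : nat) (f : 'I_m -> R -> R)
    (a : 'I_m -> R) :
  (forall i, has_integral (f i) (a i)) ->
  has_integral (fun x => \sum_(i < m) f i x)%R (\sum_(i < m) a i)%R.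
Proof.
move=> fa; split.
  under eq_fun do rewrite -sumEFin.
  by apply: integrable_sum => // i _; exact: (fa i).1.
under eq_integral do rewrite -sumEFin.
rewrite integral_sum//; last by move=> i; exact: (fa i).1.
by rewrite -sumEFin; apply: eq_bigr => i _; exact: (fa i).2.
Qed.

(* The integral is the difference of the integrals of the positive and negative
   parts, both of which are monotone even when they are infinite. *)
Lemma le_integral_measurable d (T : measurableType d) (R : realType)
    (mu : {measure set T -> \bar R}) (f g : T -> \bar R) :
  measurable_fun [set: T] f -> measurable_fun [set: T] g ->
  (forall x, f x <= g x) -> \int[mu]_x f x <= \int[mu]_x g x.
Proof.
move=> mf mg fg; rewrite integralE [leRHS]integralE.
have fgT : {in [set: T], forall x, f x <= g x} by move=> x _; exact: fg.
apply: leeB; apply: ge0_le_integral => //.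
- exact: measurable_funepos.
- exact: measurable_funepos.
- by move=> x _; apply: (funepos_le fgT); rewrite inE.
- exact: measurable_funeneg.
- exact: measurable_funeneg.
- by move=> x _; apply: (funeneg_le fgT); rewrite inE.
Qed.

(* The constant [17 / 9] is the largest [c] with [1 - c / 4 >= 19 / 36]. *)
Lemma expR_le_quadratic (R : realType) (x : R) : (`|x| <= 2^-1)%R ->
  (expR x <= 1 + x + 17 / 9 * x ^+ 2)%R.
Proof.
move=> hx.
have [x1 x2] : (- 2^-1 <= x /\ x <= 2^-1)%R by apply/andP; rewrite -ler_norml.
have h : (1 - x / 2 <= expR (- (x / 2)))%R.
  by have := expR_ge1Dx (- (x / 2))%R.
have h2 : ((1 - x / 2) ^+ 2 * expR x <= 1)%R.
  have -> : expR x = (expR (x / 2) ^+ 2)%R.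
    by rewrite expr2 -expRD; congr expR; field.
  rewrite -exprMn expr_le1//; last by apply: mulr_ge0; [lra|exact: expR_ge0].
  by rewrite mulrC -[leRHS](expRxMexpNx_1 (x / 2)) ler_pM2l ?expR_gt0.
have e0 := expR_gt0 x.
have p0 : (0 < (1 - x / 2) ^+ 2)%R by apply: exprn_gt0; lra.
(* By [h2] only a polynomial inequality is left: [(1 - x / 2) ^+ 2] times the right-hand side is at
   least 1. *)
rewrite -(ler_pM2l p0); apply: le_trans h2 _.
nra.
Qed.

(* Young's inequality for the conjugate pair [x ln x - x] and [exp]. *)
Lemma mul_ln_ge (R : realType) (x y : R) : (0 <= x)%R ->
  (x * y + x - expR y <= x * ln x)%R.
Proof.
rewrite le_eqVlt => /orP[/eqP <-|x0].
  by rewrite !mul0r add0r sub0r oppr_le0 expR_ge0.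
(* The inequality [1 + u <= expR u] at [u = y - ln x], then multiplied by [x]. *)
have := expR_ge1Dx (y - ln x).
rewrite expRB lnK ?posrE// ler_pdivlMr//.
lra.
Qed.

Lemma has_integral_density (R : realType) (p : R -> R) :
  is_density p -> has_integral p 1%R.
Proof.
move=> [mp p0 p1]; split => //; apply/integrableP; split.
  exact/measurable_EFinP.
under eq_integral do rewrite gee0_abs ?lee_fin//.
by rewrite p1 ltry.
Qed.

(** Writing the distribution function as a whole-line integral against an indicator makes it a term
    of the linear combinations used below. *)
Lemma density_cdfP (R : realType) (p : R -> R) (t : R) : is_density p ->
  exists2 a : R, (0 <= a <= 1)%R /\ density_cdf p t = a%:E &
    has_integral (fun x => p x * \1_(`]-oo, t]) x)%R a.
Proof.
move=> dp; have [mp p0 p1] := dp.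
have [pi _] := has_integral_density dp.
have cdfE : density_cdf p t =
    \int[lebesgue_measure]_x (p x * \1_(`]-oo, t]) x)%:E.
  rewrite /density_cdf integral_mkcond epatch_indic.
  by apply: eq_integral => x _; rewrite /= EFinM.
have mp1 : measurable_fun [set: R] (fun x => p x * \1_(`]-oo, t]) x)%R.
  by apply: measurable_funM => //; exact: measurable_indic.
have le1 x : (0 <= p x * \1_(`]-oo, t]) x <= p x)%R.
  by rewrite indicE; case: (x \in _); rewrite ?mulr1 ?mulr0 !p0 ?lexx.
have pti : lebesgue_measure.-integrable [set: R]
    (fun x => (p x * \1_(`]-oo, t]) x)%:E).
  apply: (le_integrable _ _ _ pi) => //; first exact/measurable_EFinP.
  move=> x _ /=; rewrite lee_fin !ger0_norm//.
    by case/andP: (le1 x).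
  by case/andP: (le1 x).
have ph := has_integralP pti.
rewrite -cdfE in ph *.
exists (fine (density_cdf p t)) => //; split; last first.
  by rewrite cdfE; rewrite fineK// integrable_fin_num.
rewrite -2!lee_fin -ph.2 -p1; apply/andP; split.
  by apply: integral_ge0 => x _; rewrite lee_fin; case/andP: (le1 x).
apply: le_integral_measurable.
- exact/measurable_EFinP.
- exact/measurable_EFinP.
- by move=> x; rewrite lee_fin; case/andP: (le1 x).
Qed.

(** On nonnegative reals [entropy_bound] inverts [c ^+ 2 / 2 + c ^+ 4 / 36], which is at most
    [19 / 36 * c ^+ 2] for [c <= 1]. *)
Lemma le_entropy_bound (R : realType) (c : R) (d : \bar R) :
  (0 <= c <= 1)%R -> ((19 / 36 * c ^+ 2)%:E <= d) -> c%:E <= entropy_bound d.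
Proof.
move=> /andP[c0 c1]; rewrite /entropy_bound; case: d => [d| |] hd; last by [].
- rewrite lee_fin in hd.
  have h1 : (1 + c ^+ 2 / 9 <= Num.sqrt (1 + 4 / 9 * d))%R.
    rewrite -[leLHS]ger0_norm; last by nra.
    rewrite -sqrtr_sqr ler_wsqrtr//.
    have : (c ^+ 2 * c ^+ 2 <= c ^+ 2 * 1)%R.
      by apply: ler_wpM2l; [exact: sqr_ge0|rewrite expr_le1].
    nra.
  have h2 : (c / 3 <= Num.sqrt (- 1 + Num.sqrt (1 + 4 / 9 * d)))%R.
    rewrite -[leLHS]ger0_norm; last by lra.
    by rewrite -sqrtr_sqr ler_wsqrtr//; nra.
  rewrite -[leRHS]/((3 * Num.sqrt (- 1 + Num.sqrt (1 + 4 / 9 * d)))%:E).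
  rewrite lee_fin; lra.
- rewrite gt0_muley ?lte_fin; last lra.
  by rewrite /= gt0_muley ?lte_fin ?leey.
Qed.

(** As [S = - ln p], [M] is the cross entropy of [q] with respect to [p], and the argument of the
    bound is their relative entropy. *)
Lemma cdf_dist_le_entropy_bound (R : realType) (p q S : R -> R) (M t : R) :
  is_density p -> is_density q -> (forall x, p x = expR (- S x)) ->
  has_integral (fun x => q x * S x)%R M ->
  `|density_cdf q t - density_cdf p t| <=
    entropy_bound (M%:E - diff_entropy q).
Proof.
move=> dp dq pE qS; have [mq q0 _] := dq.
have [a [a01 ->] pa] := density_cdfP t dp.
have [b [b01 ->] qb] := density_cdfP t dq.
have {a01 b01} /andP[u1 u2] : (- 1 <= b - a <= 1)%R.
  by case/andP: a01; case/andP: b01; lra.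
apply: le_entropy_bound; first by rewrite normr_ge0 ler_norml u1.
rewrite /diff_entropy oppeK real_normK ?num_real//.
(* Since [|b - a| <= 1], this gives [|s| <= 1 / 2], the range of the quadratic bound on [expR]. *)
set s := ((b - a) / 2)%R.
(* The expansion of [q (- S + h) + q - p (1 + h + 17 / 9 s ^ 2)], with [h] equal to [s] up to [t]
   and to [- s] beyond, into functions of known integral. *)
set f := (fun x => - 1 * (q x * S x) + (1 - s) * q x
  + (2 * s) * (q x * \1_(`]-oo, t]) x) + (- (1 - s + 17 / 9 * s ^+ 2)) * p x
  + (- (2 * s)) * (p x * \1_(`]-oo, t]) x))%R.
(* The terms in [h] contribute [2 s (b - a) = (b - a) ^ 2], and the quadratic term removes [17 / 36]
   of it. *)
have hf : has_integral f (- M + 19 / 36 * (b - a) ^+ 2)%R.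
  have -> : (- M + 19 / 36 * (b - a) ^+ 2 = - 1 * M + (1 - s) * 1
    + 2 * s * b + (- (1 - s + 17 / 9 * s ^+ 2)) * 1 + (- (2 * s)) * a)%R.
    by rewrite /s; field.
  by do ![apply: has_integralD => //| apply: has_integralZ => //];
    exact: has_integral_density.
have : \int[lebesgue_measure]_x (f x)%:E <=
    \int[lebesgue_measure]_x (q x * ln (q x))%:E.
  apply: le_integral_measurable => [| |x].
  - by case/integrableP: hf.1.
  - apply/measurable_EFinP; apply: measurable_funM => //.
    exact: measurableT_comp.
  rewrite lee_fin.
  pose h := ((2 * s) * \1_(`]-oo, t]) x - s)%R.
  have hs : h = s \/ h = (- s)%R.
    by rewrite /h indicE; case: (x \in _); [left|right]; rewrite /=; ring.
  have hn : (`|h| <= 2^-1)%R.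
    have : (`|s| <= 2^-1)%R by rewrite /s ler_norml; lra.
    by case: hs => ->; rewrite ?normrN.
  have h2 : (h ^+ 2 = s ^+ 2)%R by case: hs => ->; rewrite ?sqrrN.
  apply: le_trans (mul_ln_ge (- S x + h) (q0 x)).
  rewrite expRD -pE.
  have p0 : (0 < p x)%R by rewrite pE expR_gt0.
  have : (p x * expR h <= p x * (1 + h + 17 / 9 * s ^+ 2))%R.
    by rewrite ler_pM2l// -h2 expR_le_quadratic.
  rewrite /f /h; lra.
rewrite hf.2 => /(leeD2l M%:E).
by rewrite -EFinD addrA subrr add0r.
Qed.

(* For even [m] the top moment is an integral of a nonnegative function, so its
   finiteness alone gives integrability; it dominates the lower powers. *)
Lemma integrable_monomial_le (R : realType) (p : R -> R) (m : nat) : ~~ odd m ->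
  is_density p -> power_moment p m < +oo ->
  forall k, (k <= m)%N ->
    lebesgue_measure.-integrable [set: R] (fun x => (x ^+ k * p x)%:E).
Proof.
move=> om dp pm k km; have [mp p0 _] := dp.
have mk j : measurable_fun [set: R] (fun x : R => x ^+ j * p x)%R.
  exact: measurable_funM.
have ge0 x : (0 <= x ^+ m * p x)%R by rewrite mulr_ge0// exprn_even_ge0.
have mi : lebesgue_measure.-integrable [set: R] (fun x => (x ^+ m * p x)%:E).
  apply/integrableP; split; first by apply/measurable_EFinP; exact: mk.
  by under eq_integral do rewrite gee0_abs ?lee_fin//.
have [pi _] := has_integral_density dp.
apply: (le_integrable _ _ _ (integrableD _ pi mi)) => //.
  by apply/measurable_EFinP; exact: mk.
move=> x _; rewrite /= lee_fin.
rewrite [leRHS]ger0_norm ?addr_ge0// normrM (ger0_norm (p0 x)).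
have -> : (p x + x ^+ m * p x = (1 + x ^+ m) * p x)%R by ring.
rewrite ler_wpM2r// normrX.
have -> : (x ^+ m = `|x| ^+ m)%R by rewrite -normrX ger0_norm// exprn_even_ge0.
have [x1|x1] := leP `|x|%R 1%R.
  by rewrite (le_trans (exprn_ile1 _ _ _))// lerDl exprn_ge0.
by rewrite (le_trans (ler_weXn2l (ltW x1) km))// lerDr.
Qed.

Theorem proposition2p6 (R : realType) (n : nat) (tau qK : R -> R)
    (lam : 'I_(2 * n).+1 -> R)
    (hn : (1 <= n)%N)
    (htau : densities_upto (2 * n) tau)
    (hqK : densities_upto (2 * n) qK)
    (hmom : forall l : nat, (1 <= l <= 2 * n)%N ->
      power_moment qK l = power_moment tau l)
    (hlam : forall k : nat, (k <= 2 * n)%N ->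
      power_moment (maxent_density lam) k = power_moment tau k) :
  ks_distance qK tau <=
    entropy_bound (diff_entropy (maxent_density lam) - diff_entropy qK) +
    entropy_bound (diff_entropy (maxent_density lam) - diff_entropy tau).
Proof.
have [dtau itau] := htau; have [dqK iqK] := hqK.
set p := maxent_density lam.
pose S x := (\sum_(i < (2 * n).+1) lam i * x ^+ i)%R.
pose M := (\sum_(i < (2 * n).+1) lam i * fine (power_moment tau i))%R.
(* [hmom] starts at order 1; order 0 comes from normalization. *)
have mom0 (q : R -> R) : is_density q -> power_moment q 0 = 1.
  by move=> [_ _ <-]; apply: eq_integral => x _; rewrite expr0 mul1r.
have qmom k : (k <= 2 * n)%N -> power_moment qK k = power_moment tau k.
  case: k => [_|k hk]; first by rewrite !mom0.
  exact: hmom.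
have mS : measurable_fun [set: R] S.
  by apply: measurable_sum => i; exact: measurable_funM.
have dp : is_density p.
  split.
  - rewrite (_ : p = expR \o (fun x => - S x)%R)//.
    by apply: measurableT_comp => //; exact: measurable_funN.
  - by move=> x; exact: expR_ge0.
  - rewrite -(mom0 _ dtau) -hlam//.
    by apply: eq_integral => x _; rewrite expr0 mul1r.
(* Moment matching enters here: [M] does not depend on [q], because [S] is a polynomial of degree at
   most [2 * n]. *)
have SM (q : R -> R) : is_density q ->
    (forall k, (k <= 2 * n)%N ->
      lebesgue_measure.-integrable [set: R] (fun x => (x ^+ k * q x)%:E)) ->
    (forall k, (k <= 2 * n)%N -> power_moment q k = power_moment tau k) ->
    has_integral (fun x => q x * S x)%R M.
  move=> dq iq qE.
  have -> : (fun x => q x * S x)%R =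
      (fun x => \sum_(i < (2 * n).+1) lam i * (x ^+ i * q x))%R.
    apply/funext => x; rewrite mulr_sumr; apply: eq_bigr => i _.
    by rewrite mulrC mulrA.
  apply: has_integral_sum => i; apply: has_integralZ.
  have i2n : (i <= 2 * n)%N by rewrite -ltnS.
  by rewrite -qE//; apply: has_integralP; exact: iq.
have Hp : diff_entropy p = M%:E.
  have pS : has_integral (fun x => p x * S x)%R M.
    (* [hlam] only gives values of integrals; integrability against [p] follows from the finite
       moment of even order [2 * n]. *)
    apply: SM => // k hk.
    apply: integrable_monomial_le hk => //; first by rewrite mul2n odd_double.
    by rewrite hlam// ltey_eq integrable_fin_num// itau.
  rewrite /diff_entropy.
  have -> : (fun x => (p x * ln (p x))%:E) = (fun x => (- 1 * (p x * S x))%:E).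
    by apply/funext => x; rewrite [in ln _]/p expRK mulrN mulN1r.
  by rewrite (has_integralZ _ pS).2 mulN1r EFinN oppeK.
rewrite Hp; apply: ge_ereal_sup => _ [t _ <-].
(* All three distribution functions are finite at [t], so the triangle inequality can be taken in
   [R]. *)
have [a [_ aE] _] := density_cdfP t dp.
have [b [_ bE] _] := density_cdfP t dqK.
have [c [_ cE] _] := density_cdfP t dtau.
have := leeD (cdf_dist_le_entropy_bound t dp dqK (fun=> erefl) (SM _ dqK iqK qmom))
  (cdf_dist_le_entropy_bound t dp dtau (fun=> erefl)
    (SM _ dtau itau (fun _ _ => erefl))).
apply: le_trans; rewrite aE bE cE /= -EFinD lee_fin.
by rewrite (distrC c a) ler_distD.
Qed.
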